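(* Let $p$ be an odd prime, $f(x)\in\mathbb{Z}[x]$, $n\ge1$, and let $\sigma$ be a cycle of $f_n$ of length $k$ which splits. Let $A=\mathrm{ord}_p(a_n-1)$ and $B=\mathrm{ord}_p(b_n)$ (so $A,B\ge1$). (1) If $B<A$ and $B<n$, then every lift of $\sigma$ splits $B-1$ times, and then grows. (2) If $A\le B$ and $A<n$, then every lift of $\sigma$, except for one, splits $A-1$ times, and then grows; the single exceptional lift behaves in precisely the same way as $\sigma$. That is, there is an infinite sequence $\sigma=\sigma_n,\sigma_{n+1},\sigma_{n+2},\dots$ in which each $\sigma_{j}$ ($j\ge n$) is a cycle of $f_j$ which splits, $\sigma_{j+1}$ is a lift of $\sigma_j$, and every lift of $\sigma_j$ other than $\sigma_{j+1}$ splits $A-1$ times and then grows. (3) If $A\ge n$ and $B\ge n$, then every lift of $\sigma$ splits $n-1$ times.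
   Context: $f_n:\mathbb{Z}/p^n\mathbb{Z}\to\mathbb{Z}/p^n\mathbb{Z}$ is the map $x\mapsto f(x)\bmod p^n$; a cycle of $f_n$ is said to be at level $n$. Let $\sigma=(x_1,\dots,x_k)$ be a cycle of $f_n$ of length $k$ (distinct elements, $f_n(x_i)=x_{i+1}$, $f_n(x_k)=x_1$), with the $x_i$ viewed as integers representing their classes. Put $g=f^k$ ($k$-th iterate), $a_n=g'(x_1)$, $b_n=(g(x_1)-x_1)/p^n$. A lift of $\sigma$ is a cycle of $f_{n+1}$ all of whose elements reduce mod $p^n$ to elements of $\sigma$. The cycle $\sigma$: grows if $a_n\equiv1$ and $b_n\not\equiv0\pmod p$ (then it has a single lift, of length $pk$); splits if $a_n\equiv1$ and $b_n\equiv0\pmod p$ (then it has $p$ lifts, each of length $k$). These conditions are independent of the choices. The same terms apply at every level. The descendants of a cycle $\tau$ at level $N$ are $\tau$ itself (at level $N$), its lifts (at level $N+1$), the lifts of those (at level $N+2$), and so on. A cycle $\tau$ at level $N$ ''splits $s$ times'' if all its descendants at levels $N,N+1,\dots,N+s-1$ split (no condition if $s=0$); it ''splits $s$ times and then grows'' if in addition all its descendants at level $N+s$ grow. $\mathrm{ord}_p$ is the $p$-adic valuation, with $\mathrm{ord}_p(0)=\infty$. *)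

(* Defs.v *)
From mathcomp Require Import all_boot all_order all_algebra.

Set Implicit Arguments.
Unset Strict Implicit.
Unset Printing Implicit Defensive.

Import Order.TTheory GRing.Theory Num.Theory.

Local Open Scope ring_scope.

(* Residues mod p ^ n are elements of 'Z_(p ^ n); this is the intended ring   *)
(* as soon as p ^ n > 1, and only levels n >= 1 are ever used.                *)

Definition fmod (p : nat) (f : {poly int}) (n : nat) (x : 'Z_(p ^ n)) :
  'Z_(p ^ n) := (f.[(x : nat)%:Z])%:~R.

(* A cycle is given by the list x_1, ..., x_k of its elements; the starting   *)
(* point is a choice, so two lists c, d denote the same cycle iff c =i d.     *)
Definition is_cycle (p : nat) (f : {poly int}) (n : nat)
    (c : seq 'Z_(p ^ n)) : bool :=
  [&& c != [::], fcycle (@fmod p f n) c & uniq c].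

Definition is_lift (p : nat) (f : {poly int}) (n : nat)
    (c : seq 'Z_(p ^ n)) (d : seq 'Z_(p ^ n.+1)) : Prop :=
  is_cycle f d /\ forall y, y \in d -> (y : nat)%:R \in c.

Definition iter_poly (f : {poly int}) (k : nat) : {poly int} :=
  iter k (fun q => f \Po q) 'X.

Definition cycle_a (f : {poly int}) (k : nat) (x : int) : int :=
  (iter_poly f k)^`().[x].

(* The division is exact whenever x represents an element of a cycle of       *)
(* length k at level n.                                                       *)
Definition cycle_b (p : nat) (f : {poly int}) (n k : nat) (x : int) : int :=
  (((iter_poly f k).[x] - x) %/ (p ^ n)%:Z)%Z.

(* Growing and splitting do not depend on the integer x representing an       *)
(* element of the cycle; we take the least nonnegative one for x_1.           *)
Definition cycle_rep (p n : nat) (c : seq 'Z_(p ^ n)) : int :=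
  (head 0 c : nat)%:Z.

Definition grows (p : nat) (f : {poly int}) (n : nat)
    (c : seq 'Z_(p ^ n)) : Prop :=
  (cycle_a f (size c) (cycle_rep c) = 1 %[mod p])%Z /\
  (cycle_b p f n (size c) (cycle_rep c) <> 0 %[mod p])%Z.

Definition splits (p : nat) (f : {poly int}) (n : nat)
    (c : seq 'Z_(p ^ n)) : Prop :=
  (cycle_a f (size c) (cycle_rep c) = 1 %[mod p])%Z /\
  (cycle_b p f n (size c) (cycle_rep c) = 0 %[mod p])%Z.

Inductive descendant (p : nat) (f : {poly int}) (N : nat)
    (c : seq 'Z_(p ^ N)) : forall m : nat, seq 'Z_(p ^ m) -> Prop :=
| descendant_refl : descendant f c c
| descendant_lift (m : nat) (d : seq 'Z_(p ^ m)) (e : seq 'Z_(p ^ m.+1)) :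
    descendant f c d -> is_lift f d e -> descendant f c e.

Definition splits_times (p : nat) (f : {poly int}) (s N : nat)
    (c : seq 'Z_(p ^ N)) : Prop :=
  forall (m : nat) (d : seq 'Z_(p ^ m)),
    (m < N + s)%N -> descendant f c d -> splits f d.

Definition splits_times_then_grows (p : nat) (f : {poly int}) (s N : nat)
    (c : seq 'Z_(p ^ N)) : Prop :=
  splits_times f s c /\
  forall d : seq 'Z_(p ^ (N + s)), descendant f c d -> grows f d.

(* The p-adic valuation with values in nat extended by None = infinity.       *)
Definition ord_p (p : nat) (m : int) : option nat :=
  if m == 0 then None else Some (logn p `|m|%N).

Definition ord_le (u v : option nat) : bool :=
  match u, v with
  | _, None => true
  | None, Some _ => false
  | Some i, Some j => (i <= j)%N
  end.

Definition ord_lt (u v : option nat) : bool := ~~ ord_le v u.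

(* Main.v *)
(* Put k = size sigma, g = f^k and h(y) = g(y) - y ([displacement]).  Every
   integer y over sigma is f^i(x) + p^n t, and a Taylor expansion gives
   h(y) = w h(x) + p^n t (g'(x) - 1) + p^(2n) r with w a unit mod p.  As long as
   p^m divides h on all integers over a lift of sigma, its descendants up to
   level m keep the length k, and such a descendant at level m splits or grows
   according to whether p^(m+1) divides h; so everything is read off the
   valuation of h.  It equals n + B everywhere over sigma in case (1), is at
   least 2n in case (3), and in case (2) it is n + A except over one lift, where
   it is larger and the same analysis applies one level up. *)
Require Import Defs.
From mathcomp Require Import all_boot all_order all_algebra.
From mathcomp Require Import ring.

Set Implicit Arguments.
Unset Strict Implicit.
Unset Printing Implicit Defensive.

Import Order.TTheory GRing.Theory Num.Theory.

Local Open Scope ring_scope.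

(** * Divisibility, Taylor expansion and iterates *)

(* The [rpred] lemmas, with the goals they leave kept in [%|] form. *)
Lemma dvdz_add (d m n : int) : (d %| m)%Z -> (d %| n)%Z -> (d %| m + n)%Z.
Proof. exact: rpredD. Qed.

Lemma dvdz_addl (d m n : int) : (d %| m)%Z -> (d %| m + n)%Z = (d %| n)%Z.
Proof. exact: rpredDl. Qed.

Lemma dvdz_addr (d m n : int) : (d %| n)%Z -> (d %| m + n)%Z = (d %| m)%Z.
Proof. exact: rpredDr. Qed.

(** Induction on [q] produces the quadratic remainder directly, so no division by 2 occurs. *)
Lemma horner_taylor2 (R : comNzRingType) (q : {poly R}) (x t : R) :
  exists r, q.[x + t] = q.[x] + q^`().[x] * t + r * t ^+ 2.
Proof.
elim/poly_ind: q => [|q c [r IH]].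
  by exists 0; rewrite deriv0 !horner0 !mul0r !addr0.
exists (r * (x + t) + q^`().[x]).
by rewrite derivMXaddC !(hornerMXaddC, hornerD, hornerM, hornerX) IH; ring.
Qed.

Lemma dvdz_horner_sub (q : {poly int}) (d x y : int) :
  (d %| x - y)%Z -> (d %| q.[x] - q.[y])%Z.
Proof.
move=> /dvdzP[t xy]; have [r qr] := horner_taylor2 q y (t * d).
have -> : x = y + t * d by rewrite -xy addrC subrK.
apply/dvdzP; exists (q^`().[y] * t + r * t ^+ 2 * d).
by rewrite qr; ring.
Qed.

Lemma iter_polyD (f : {poly int}) (i j : nat) :
  iter_poly f (i + j) = iter_poly f i \Po iter_poly f j.
Proof.
rewrite /iter_poly; elim: i => [|i IH] /=; first by rewrite comp_polyX.
by rewrite IH comp_polyA.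
Qed.

Lemma horner_iter_polyD (f : {poly int}) (i j : nat) (x : int) :
  (iter_poly f (i + j)).[x] = (iter_poly f i).[(iter_poly f j).[x]].
Proof. by rewrite iter_polyD horner_comp. Qed.

(** Chain rule. *)
Lemma cycle_aD (f : {poly int}) (i j : nat) (x : int) :
  cycle_a f (i + j) x = cycle_a f i (iter_poly f j).[x] * cycle_a f j x.
Proof. by rewrite /cycle_a iter_polyD deriv_comp hornerM horner_comp. Qed.

(** * Displacements and derivatives along an integer orbit *)

Definition displacement (f : {poly int}) (k : nat) (x : int) : int :=
  (iter_poly f k).[x] - x.

Lemma coprimez_subr1 (d a : int) : (d %| a - 1)%Z -> coprimez d a.
Proof.
move=> /dvdzP[t at1]; apply/coprimezP; exists (- t, 1) => /=.
by rewrite mulNr -at1; ring.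
Qed.

(** By the chain rule the derivative of f^i at x is a factor of that of f^k. *)
Lemma coprime_cycle_a (d : int) (f : {poly int}) (k i : nat) (x : int) :
  (i <= k)%N -> coprimez d (cycle_a f k x) -> coprimez d (cycle_a f i x).
Proof.
by move=> /subnK <-; rewrite cycle_aD coprimezMr => /andP[].
Qed.

(* Compare the two expressions for the derivative of f^(k + i) at x. *)
Lemma cycle_a_shift (d : int) (f : {poly int}) (k i : nat) (x : int) :
    (i <= k)%N -> coprimez d (cycle_a f k x) ->
    (d %| displacement f k x)%Z ->
  (d %| cycle_a f k (iter_poly f i).[x] - cycle_a f k x)%Z.
Proof.
move=> ik cop dx; have copi := coprime_cycle_a ik cop.
rewrite -(Gauss_dvdzl _ copi) mulrBl -cycle_aD addnC cycle_aD.
rewrite [_ * cycle_a f i x]mulrC -mulrBl dvdz_mulr //.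
exact: dvdz_horner_sub.
Qed.

Lemma cycle_a_near (d : int) (f : {poly int}) (k i : nat) (x y : int) :
    (i <= k)%N -> coprimez d (cycle_a f k x) ->
    (d %| displacement f k x)%Z -> (d %| y - (iter_poly f i).[x])%Z ->
  (d %| cycle_a f k y - cycle_a f k x)%Z.
Proof.
move=> ik cop dx dy.
have := dvdz_add (dvdz_horner_sub (iter_poly f k)^`() dy)
               (cycle_a_shift ik cop dx).
by rewrite addrA subrK.
Qed.

(* The factor w is a unit mod p because f^i has a unit derivative at x. *)
Lemma displacement_shift (p : int) (f : {poly int}) (k i : nat) (x : int) :
    (i <= k)%N -> coprimez p (cycle_a f k x) ->
    (p %| displacement f k x)%Z ->
  exists2 w, coprimez p w &
    displacement f k (iter_poly f i).[x] = w * displacement f k x.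
Proof.
move=> ik cop px; have copi := coprime_cycle_a ik cop.
(* As f^k and f^i commute, the displacement at f^i(x) is f^i(x + h) - f^i(x), with h the
   displacement at x; w is its Taylor quotient by h. *)
have [r hr] := horner_taylor2 (iter_poly f i) x (displacement f k x).
exists (cycle_a f i x + r * displacement f k x).
  case/coprimezP: copi => -[u v] /= uv; case/dvdzP: px => t ->.
  by apply/coprimezP; exists (u - v * r * t, v); rewrite /= -uv; ring.
rewrite {1}/displacement -horner_iter_polyD addnC horner_iter_polyD.
have -> : (iter_poly f k).[x] = x + displacement f k x.
  by rewrite /displacement addrC subrK.
by rewrite hr /cycle_a; ring.
Qed.

(** Taylor expansion of f^k at f^i(x). Replacing the derivative there by the one at x costs a
    multiple of p^n, which the factor p^n t moves into the p^(2n) term. Since w comes before t, t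
    may be chosen in terms of w. *)
Lemma displacement_near (p : int) (f : {poly int}) (n k i : nat) (x : int) :
    (0 < n)%N -> (i <= k)%N -> (p %| cycle_a f k x - 1)%Z ->
    (p ^+ n %| displacement f k x)%Z ->
  exists2 w, coprimez p w & forall t, exists r,
    displacement f k ((iter_poly f i).[x] + p ^+ n * t) =
      w * displacement f k x + p ^+ n * t * (cycle_a f k x - 1)
        + p ^+ (n + n) * r.
Proof.
move=> n0 ik pa pnx; have cop := coprimez_subr1 pa.
have px : (p %| displacement f k x)%Z.
  by apply: dvdz_trans pnx; rewrite -(prednK n0) exprS dvdz_mulr.
have [w cw hw] := displacement_shift ik cop px.
have /dvdzP[s hs] := cycle_a_shift ik (coprimezXl n cop) pnx.
exists w => // t.
have [r hr] := horner_taylor2 (iter_poly f k) (iter_poly f i).[x] (p ^+ n * t).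
exists (s * t + r * t ^+ 2).
rewrite -hw /displacement hr -/(cycle_a f k (iter_poly f i).[x]).
by rewrite -[cycle_a f k (iter_poly f i).[x]](subrK (cycle_a f k x)) hs exprD; ring.
Qed.

(** * Valuations as divisibility *)

Lemma ord_le_dvd (p : nat) (v : nat) (m : int) : prime p ->
  ord_le (Some v) (ord_p p m) = (p%:Z ^+ v %| m)%Z.
Proof.
move=> hp; rewrite /ord_p; case: eqVneq => [->|m0]; first by rewrite dvdz0.
rewrite /= dvdzE abszX absz_nat pfactor_dvdn //.
by rewrite absz_gt0.
Qed.

Lemma ord_lt_Some (v : nat) (u : option nat) :
  ord_lt (Some v) u = ord_le (Some v.+1) u.
Proof. by case: u => //= i; rewrite /ord_lt /= ltnNge. Qed.

Lemma ord_p_Some (p v : nat) (m : int) : prime p -> ord_p p m = Some v ->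
  (p%:Z ^+ v %| m)%Z /\ ~~ (p%:Z ^+ v.+1 %| m)%Z.
Proof. by move=> hp hv; rewrite -!ord_le_dvd // hv /= leqnn ltnn. Qed.

(** * Residues, cycles and lifts, handled through integer representatives *)

Lemma intr_Zp_eq (q : nat) (x y : int) : (1 < q)%N ->
  (x%:~R == y%:~R :> 'Z_q) = (q %| x - y)%Z.
Proof.
move=> q1; rewrite -subr_eq0 -rmorphB /=.
have natP (m : nat) : (m%:R == 0 :> 'Z_q) = (q %| m)%N.
  by rewrite -val_eqE /= val_Zp_nat.
case: (x - y) => m; first exact: natP.
by rewrite NegzE rmorphN oppr_eq0 dvdzE abszN; exact: natP.
Qed.

(** Only r mod [size c] matters, and the iterates below [size c] are distinct. *)
Lemma iter_fcycle_eq (T : finType) (g : T -> T) (c : seq T) (x : T) (r : nat) :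
  fcycle g c -> uniq c -> x \in c -> (iter r g x == x) = (size c %| r)%N.
Proof.
move=> gc uc xc; have sz := order_cycle gc uc xc.
have per : iter (size c) g x = x by rewrite -sz; exact: (iter_order_cycle gc).
have perM j : iter (j * size c) g x = x.
  by elim: j => // j IH; rewrite mulSn iterD IH.
have s0 : (0 < size c)%N by case: (c) xc.
apply/eqP/idP => [|/dvdnP[j ->]]; last exact: perM.
rewrite {1}(divn_eq r (size c)) addnC iterD perM => it.
have lt : (r %% size c < order g x)%N by rewrite sz ltn_mod.
by have := findex_iter lt; rewrite it findex0 /dvdn => <-.
Qed.

Lemma fcycle_iter (T : finType) (g : T -> T) (c : seq T) (x y : T) :
  fcycle g c -> uniq c -> x \in c -> y \in c ->
  exists2 i, (i < size c)%N & iter i g x = y.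
Proof.
move=> gc uc xc yc; have xy : fconnect g x y by rewrite (fconnect_cycle gc).
exists (findex g x y); last exact: iter_findex.
by rewrite -(order_cycle gc uc xc) findex_max.
Qed.

Lemma fcycle_eq_mem (T : finType) (g : T -> T) (c d : seq T) (x : T) :
  fcycle g c -> fcycle g d -> x \in c -> x \in d -> c =i d.
Proof.
by move=> gc gd xc xd y; rewrite -(fconnect_cycle gc xc) (fconnect_cycle gd xd).
Qed.

(** For n = 0 the ring ['Z_(p ^ n)] would have two elements, hence the positive levels here and
    below. *)
Lemma intr_Zpow_eq (p n : nat) (x y : int) : (1 < p)%N -> (0 < n)%N ->
  (x%:~R == y%:~R :> 'Z_(p ^ n)) = (p%:Z ^+ n %| x - y)%Z.
Proof.
move=> p1 n0; rewrite intr_Zp_eq; first by rewrite !dvdzE abszX.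
by rewrite -(exp1n n) ltn_exp2r.
Qed.

Lemma intr_Zp (q : nat) (z : 'Z_q) : (z : nat)%:Z%:~R = z.
Proof. exact: natr_Zp. Qed.

Lemma reduce_intr (p m : nat) (x : int) : (1 < p)%N -> (0 < m)%N ->
  ((x%:~R : 'Z_(p ^ m.+1)) : nat)%:R = x%:~R :> 'Z_(p ^ m).
Proof.
move=> p1 m0; set z : 'Z_(p ^ m.+1) := x%:~R.
have /eqP : (z : nat)%:Z%:~R == x%:~R :> 'Z_(p ^ m.+1) by rewrite intr_Zp.
move=> /eqP; rewrite intr_Zpow_eq // => zx.
apply/eqP; rewrite -[_%:R]/((z : nat)%:Z%:~R) intr_Zpow_eq //.
by apply: dvdz_trans zx; rewrite dvdz_exp2l.
Qed.

Lemma fmod_intr (p : nat) (f : {poly int}) (n : nat) (x : int) :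
  (1 < p)%N -> (0 < n)%N ->
  fmod f (x%:~R : 'Z_(p ^ n)) = (f.[x])%:~R.
Proof.
move=> p1 n0; apply/eqP; rewrite /fmod intr_Zpow_eq //.
by apply: dvdz_horner_sub; rewrite -intr_Zpow_eq // intr_Zp.
Qed.

Lemma iter_fmod_intr (p : nat) (f : {poly int}) (n i : nat) (x : int) :
  (1 < p)%N -> (0 < n)%N ->
  iter i (@fmod p f n) x%:~R = ((iter_poly f i).[x])%:~R.
Proof.
move=> p1 n0; elim: i => [|i IH]; first by rewrite /= hornerX.
by rewrite iterS IH fmod_intr // -horner_comp.
Qed.

(** Gives equality of lists and not just of sets, so that the chain in case (2) starts at [sigma]
    itself. *)
Lemma is_cycle_traject (p : nat) (f : {poly int}) (n : nat)
    (c : seq 'Z_(p ^ n)) :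
  is_cycle f c -> c = traject (@fmod p f n) (head 0 c) (size c).
Proof.
case: c => [//|z c] /and3P[_ /=]; rewrite rcons_path => /andP[pc _] _.
by rewrite {1}(fpathE pc).
Qed.

Lemma fcycle_traject (T : eqType) (g : T -> T) (x : T) (k : nat) :
  iter k g x = x -> fcycle g (traject g x k).
Proof.
case: k => // k gx; rewrite (_ : fcycle _ _ = fpath g x (traject g (g x) k.+1)).
  exact: fpath_traject.
by rewrite [in RHS]trajectSr -iterSr gx.
Qed.

Lemma cycle_rep_mem (p : nat) (f : {poly int}) (n : nat)
    (c : seq 'Z_(p ^ n)) : is_cycle f c -> (cycle_rep c)%:~R \in c.
Proof.
case/and3P=> + _ _; rewrite /cycle_rep intr_Zp.
by case: c => //= z c _; rewrite mem_head.
Qed.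

(** The bridge from lengths to arithmetic: both sides say that f^r fixes x mod p^n. *)
Lemma size_cycle_dvd (p : nat) (f : {poly int}) (n : nat)
    (c : seq 'Z_(p ^ n)) (x : int) (r : nat) :
    (1 < p)%N -> (0 < n)%N -> is_cycle f c -> x%:~R \in c ->
  (size c %| r)%N = (p%:Z ^+ n %| displacement f r x)%Z.
Proof.
move=> p1 n0 /and3P[_ fc uc] xc.
by rewrite -(iter_fcycle_eq r fc uc xc) iter_fmod_intr // intr_Zpow_eq.
Qed.

Lemma cycle_orbit (p : nat) (f : {poly int}) (n : nat)
    (c : seq 'Z_(p ^ n)) (x y : int) :
    (1 < p)%N -> (0 < n)%N -> is_cycle f c -> x%:~R \in c -> y%:~R \in c ->
  exists2 i, (i <= size c)%N & (p%:Z ^+ n %| y - (iter_poly f i).[x])%Z.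
Proof.
move=> p1 n0 /and3P[_ fc uc] xc yc.
have [i isz /esym/eqP] := fcycle_iter fc uc xc yc.
rewrite iter_fmod_intr // intr_Zpow_eq // => iy.
by exists i => //; exact: ltnW.
Qed.

Lemma lift_reduce (p : nat) (f : {poly int}) (m : nat)
    (c : seq 'Z_(p ^ m)) (e : seq 'Z_(p ^ m.+1)) (y : int) :
    (1 < p)%N -> (0 < m)%N -> is_lift f c e -> y%:~R \in e -> y%:~R \in c.
Proof. by move=> p1 m0 [_ ec] /ec; rewrite reduce_intr. Qed.

(** The lengths divide each other: f^(size c) fixes y mod p^(m+1), and a return of y at level m+1
    reduces to one at level m. *)
Lemma size_lift (p : nat) (f : {poly int}) (m : nat)
    (c : seq 'Z_(p ^ m)) (e : seq 'Z_(p ^ m.+1)) (y : int) :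
    (1 < p)%N -> (0 < m)%N -> is_cycle f c -> is_lift f c e -> y%:~R \in e ->
    (p%:Z ^+ m.+1 %| displacement f (size c) y)%Z ->
  size e = size c.
Proof.
move=> p1 m0 cc le ye dy; have yc := lift_reduce p1 m0 le ye.
case: le => ce _; apply/eqP; rewrite eqn_dvd.
rewrite (size_cycle_dvd _ p1 _ ce ye) // dy (size_cycle_dvd _ p1 m0 cc yc).
apply: (@dvdz_trans (p%:Z ^+ m.+1)); first by rewrite dvdz_exp2l.
by rewrite -(size_cycle_dvd _ p1 _ ce ye).
Qed.

(** Reduction mod p^m carries the upper trajectory to the lower one, so distinctness is inherited
    from below; the displacement condition closes the upper one. *)
Lemma traject_is_lift (p : nat) (f : {poly int}) (m k : nat) (x y : int) :
    (1 < p)%N -> (0 < m)%N -> (p%:Z ^+ m %| y - x)%Z ->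
    (p%:Z ^+ m.+1 %| displacement f k y)%Z ->
    is_cycle f (traject (@fmod p f m) x%:~R k) ->
  is_lift f (traject (@fmod p f m) x%:~R k) (traject (@fmod p f m.+1) y%:~R k).
Proof.
move=> p1 m0 yx dy /and3P[c0 _ uc].
have yxE : y%:~R = x%:~R :> 'Z_(p ^ m) by apply/eqP; rewrite intr_Zpow_eq.
pose red (z : 'Z_(p ^ m.+1)) : 'Z_(p ^ m) := (z : nat)%:R.
have red_map : map red (traject (@fmod p f m.+1) y%:~R k)
    = traject (@fmod p f m) x%:~R k.
  rewrite -yxE; elim: (k) (y) => //= k' IH y'.
  by rewrite /red reduce_intr // !fmod_intr // IH.
split; last by move=> z /(map_f red); rewrite red_map.
apply/and3P; split.
- by move: c0; rewrite -!size_eq0 !size_traject.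
- by apply: fcycle_traject; apply/eqP; rewrite iter_fmod_intr // intr_Zpow_eq.
- by apply: (@map_uniq _ _ red); rewrite red_map.
Qed.

(** * Splitting, growing and descendants in terms of the displacement *)

Lemma cycle_b_dvd (p : nat) (f : {poly int}) (n k v : nat) (x : int) :
    (0 < p)%N -> (p%:Z ^+ n %| displacement f k x)%Z ->
  (p%:Z ^+ v %| cycle_b p f n k x)%Z
    = (p%:Z ^+ (n + v) %| displacement f k x)%Z.
Proof.
move=> p0; have pE : (p ^ n)%N%:Z = p%:Z ^+ n by rewrite -!natz natrX.
move=> /divzK dK; rewrite /cycle_b pE -/(displacement f k x).
rewrite -{2}dK addnC exprD dvdz_mul2r //.
by rewrite expf_neq0 // -lt0n.
Qed.

Lemma splits_cycleP (p : nat) (f : {poly int}) (n : nat)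
    (c : seq 'Z_(p ^ n)) :
    (1 < p)%N -> (0 < n)%N -> is_cycle f c ->
  splits f c <-> (p %| cycle_a f (size c) (cycle_rep c) - 1)%Z
    && (p%:Z ^+ n.+1 %| displacement f (size c) (cycle_rep c))%Z.
Proof.
move=> p1 n0 cc; have dc := size_cycle_dvd (size c) p1 n0 cc (cycle_rep_mem cc).
rewrite /splits -[n.+1]addn1 -cycle_b_dvd -?dc ?(ltnW p1) // expr1.
rewrite -{2}[cycle_b _ _ _ _ _]subr0 -!eqz_mod_dvd.
split=> [[-> ->]|/andP[/eqP -> /eqP ->] //]; by rewrite !eqxx.
Qed.

Lemma grows_cycleP (p : nat) (f : {poly int}) (n : nat)
    (c : seq 'Z_(p ^ n)) :
    (1 < p)%N -> (0 < n)%N -> is_cycle f c ->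
  grows f c <-> (p %| cycle_a f (size c) (cycle_rep c) - 1)%Z
    && ~~ (p%:Z ^+ n.+1 %| displacement f (size c) (cycle_rep c))%Z.
Proof.
move=> p1 n0 cc; have dc := size_cycle_dvd (size c) p1 n0 cc (cycle_rep_mem cc).
rewrite /grows -[n.+1]addn1 -cycle_b_dvd -?dc ?(ltnW p1) // expr1.
rewrite -{2}[cycle_b _ _ _ _ _]subr0 -!eqz_mod_dvd.
by split=> [[-> /eqP ->]|/andP[/eqP -> /eqP]]; rewrite ?eqxx.
Qed.

(** [size_lift] applies at each level up to M. The bound N <= m is carried through the induction to
    keep levels positive. *)
Lemma descendant_constant_size (p : nat) (f : {poly int}) (N M m : nat)
    (tau : seq 'Z_(p ^ N)) (d : seq 'Z_(p ^ m)) :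
    (1 < p)%N -> (0 < N)%N -> is_cycle f tau ->
    (forall y, y%:~R \in tau -> (p%:Z ^+ M %| displacement f (size tau) y)%Z) ->
    descendant f tau d -> (m <= M)%N ->
  [/\ (N <= m)%N, is_cycle f d, size d = size tau &
      forall y, y%:~R \in d -> y%:~R \in tau].
Proof.
move=> p1 N0 ct dt; elim=> {m d} [|m d e _ IH de] mM; first by split.
have [Nm cd sd dtau] := IH (ltnW mM); have m0 := leq_trans N0 Nm.
have etau y : y%:~R \in e -> y%:~R \in tau.
  by move=> /(lift_reduce p1 m0 de) /dtau.
have [ce _] := de; split=> //; first exact: leqW.
rewrite -sd; apply: (size_lift p1 m0 cd de (cycle_rep_mem ce)).
rewrite sd; apply: dvdz_trans (dt _ (etau _ (cycle_rep_mem ce))).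
by rewrite dvdz_exp2l.
Qed.

(** A descendant at level m < N + s keeps its length, and m + 1 <= N + s supplies the extra factor p
    that makes it split. *)
Lemma splits_times_dvd (p : nat) (f : {poly int}) (N s : nat)
    (tau : seq 'Z_(p ^ N)) :
    (1 < p)%N -> (0 < N)%N -> is_cycle f tau ->
    (forall y, y%:~R \in tau -> (p %| cycle_a f (size tau) y - 1)%Z
      /\ (p%:Z ^+ (N + s) %| displacement f (size tau) y)%Z) ->
  splits_times f s tau.
Proof.
move=> p1 N0 ct dt m d mM taud.
have [|Nm cd sd dtau] := descendant_constant_size p1 N0 ct _ taud (ltnW mM).
  by move=> y /dt[].
apply/splits_cycleP => //; first exact: leq_trans Nm.
have [pa pd] := dt _ (dtau _ (cycle_rep_mem cd)).
by rewrite sd pa; apply: dvdz_trans pd; rewrite dvdz_exp2l.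
Qed.

(** At level N + s the length is still constant, but the extra factor p is now missing. *)
Lemma splits_times_then_grows_dvd (p : nat) (f : {poly int}) (N s : nat)
    (tau : seq 'Z_(p ^ N)) :
    (1 < p)%N -> (0 < N)%N -> is_cycle f tau ->
    (forall y, y%:~R \in tau -> [/\ (p %| cycle_a f (size tau) y - 1)%Z,
       (p%:Z ^+ (N + s) %| displacement f (size tau) y)%Z
     & ~~ (p%:Z ^+ (N + s).+1 %| displacement f (size tau) y)%Z]) ->
  splits_times_then_grows f s tau.
Proof.
move=> p1 N0 ct dt; split; first by apply: splits_times_dvd => // y /dt[].
move=> d taud.
have [|Nm cd sd dtau] := descendant_constant_size p1 N0 ct _ taud (leqnn _).
  by move=> y /dt[].
apply/grows_cycleP => //; first exact: leq_trans Nm.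
by have [pa _ pd] := dt _ (dtau _ (cycle_rep_mem cd)); rewrite sd pa.
Qed.

(** * The displacement over a whole cycle *)

(* Every integer over the cycle is f^i(x) up to a multiple of p^n, so this
   expansion controls the displacement on the whole cycle. *)
Lemma displacement_cycle (p : nat) (f : {poly int}) (n : nat)
    (c : seq 'Z_(p ^ n)) (x y : int) (k := size c) :
    (1 < p)%N -> (0 < n)%N -> is_cycle f c -> x%:~R \in c -> y%:~R \in c ->
    (p %| cycle_a f k x - 1)%Z ->
  [/\ (p%:Z ^+ n %| cycle_a f k y - cycle_a f k x)%Z,
      (p %| cycle_a f k y - 1)%Z &
      exists i t w r, [/\ y = (iter_poly f i).[x] + p%:Z ^+ n * t,
        coprimez p w &
        displacement f k y = w * displacement f k x
          + p%:Z ^+ n * t * (cycle_a f k x - 1) + p%:Z ^+ (n + n) * r]].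
Proof.
move=> p1 n0 cc xc yc pa.
have [i ik iy] := cycle_orbit p1 n0 cc xc yc.
have dx : (p%:Z ^+ n %| displacement f k x)%Z.
  by rewrite -(size_cycle_dvd k p1 n0 cc xc).
have ayx := cycle_a_near ik (coprimezXl n (coprimez_subr1 pa)) dx iy.
split=> //.
  rewrite -(subrK (cycle_a f k x) (cycle_a f k y)) -addrA dvdz_add //.
  by apply: dvdz_trans ayx; rewrite dvdz_exp.
case/dvdzP: iy => t ty.
have [w cw /(_ t) [r hw]] := displacement_near n0 ik pa dx.
have yE : y = (iter_poly f i).[x] + p%:Z ^+ n * t.
  by rewrite [_ * t]mulrC -ty addrC subrK.
by exists i, t, w, r; split=> //; rewrite yE.
Qed.

(** Both correction terms of the expansion vanish mod p^M and w is a unit mod p, so divisibility by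
    p^M is the same all over the cycle. *)
Lemma displacement_cycle_dvd (p : nat) (f : {poly int}) (n M : nat)
    (c : seq 'Z_(p ^ n)) (x y : int) (k := size c) :
    (1 < p)%N -> (0 < n)%N -> is_cycle f c -> x%:~R \in c -> y%:~R \in c ->
    (p %| cycle_a f k x - 1)%Z -> (M <= n + n)%N ->
    (p%:Z ^+ M %| p%:Z ^+ n * (cycle_a f k x - 1))%Z ->
  (p%:Z ^+ M %| displacement f k y)%Z = (p%:Z ^+ M %| displacement f k x)%Z.
Proof.
move=> p1 n0 cc xc yc pa Mn Ma.
have [_ _ [i [t [w [r [_ cw ->]]]]]] := displacement_cycle p1 n0 cc xc yc pa.
rewrite -addrA dvdz_addr; last first.
  by rewrite mulrAC; apply: dvdz_add; apply: dvdz_mulr; rewrite // dvdz_exp2l.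
by rewrite Gauss_dvdzr // coprimezXl.
Qed.

(** Frees splitting from the choice of [cycle_rep]: this is the comparison with M = n + 1 <= 2n. *)
Lemma splits_mem (p : nat) (f : {poly int}) (n : nat)
    (c : seq 'Z_(p ^ n)) (y : int) :
    (1 < p)%N -> (0 < n)%N -> is_cycle f c -> splits f c -> y%:~R \in c ->
  (p %| cycle_a f (size c) y - 1)%Z
    /\ (p%:Z ^+ n.+1 %| displacement f (size c) y)%Z.
Proof.
move=> p1 n0 cc /(splits_cycleP p1 n0 cc) /andP[pa pd] yc.
have xc := cycle_rep_mem cc.
have [_ py _] := displacement_cycle p1 n0 cc xc yc pa.
split=> //; rewrite (displacement_cycle_dvd p1 n0 cc xc yc pa) //.
  by rewrite -[n.+1]addn1 leq_add2l.
by rewrite exprSr dvdz_mul.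
Qed.

Lemma size_lift_splits (p : nat) (f : {poly int}) (n : nat)
    (c : seq 'Z_(p ^ n)) (e : seq 'Z_(p ^ n.+1)) :
    (1 < p)%N -> (0 < n)%N -> is_cycle f c -> splits f c -> is_lift f c e ->
  size e = size c.
Proof.
move=> p1 n0 cc sc le; have [ce _] := le; have ye := cycle_rep_mem ce.
apply: (size_lift p1 n0 cc le ye).
by have [] := splits_mem p1 n0 cc sc (lift_reduce p1 n0 le ye).
Qed.

(** * The exceptional lift *)

(* A linear congruence mod p for t, solvable because (f^k)'(x) - 1 is exactly
   divisible by p^A; uniqueness of t is [exceptional_lift_unique]. *)
Lemma exceptional_lift_exists (p : nat) (f : {poly int}) (j A k : nat)
    (x : int) :
    prime p -> (0 < A)%N -> (A < j)%N ->
    (p%:Z ^+ A %| cycle_a f k x - 1)%Z ->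
    ~~ (p%:Z ^+ A.+1 %| cycle_a f k x - 1)%Z ->
    (p%:Z ^+ (j + A) %| displacement f k x)%Z ->
  exists y, (p%:Z ^+ j %| y - x)%Z
    && (p%:Z ^+ (j.+1 + A) %| displacement f k y)%Z.
Proof.
move=> hp A0 Aj pA nA /dvdzP[c hc].
have pa : (p %| cycle_a f k x - 1)%Z.
  by apply: dvdz_trans pA; rewrite dvdz_exp.
case/dvdzP: pA nA => u hu; rewrite hu exprS dvdz_mul2r; last first.
  by rewrite expf_neq0 // -lt0n prime_gt0.
move=> nu; have /coprimezP[[s v] /= sv] : coprimez u p.
  by rewrite coprimez_sym coprimezE prime_coprime.
have pj : (p%:Z ^+ j %| displacement f k x)%Z.
  by rewrite hc exprD mulrCA dvdz_mulr.
have j0 : (0 < j)%N := leq_ltn_trans (leq0n A) Aj.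
have [w cw /(_ (- (w * c * s))) [r]] := displacement_near j0 (leq0n k) pa pj.
rewrite [(iter_poly f 0).[x]]hornerX hu hc => hw.
(* Mod p^(2j) the displacement at x + p^j t is p^(j+A) (w c + t u); since s inverts u mod p, t = - w
   c s makes the bracket divisible by p. *)
exists (x + p%:Z ^+ j * - (w * c * s)).
rewrite {1}[x + _]addrC addrK dvdz_mulr //= hw.
have -> : w * (c * p%:Z ^+ (j + A)) + p%:Z ^+ j * - (w * c * s) * (u * p%:Z ^+ A)
    = p%:Z ^+ (j.+1 + A) * (w * c * v).
  by rewrite addSn exprS exprD -[w * (c * _)]mulr1 -sv; ring.
by rewrite dvdz_add ?dvdz_mulr // dvdz_exp2l // addSnnS leq_add2l.
Qed.

(** Comparing the displacements at x and y through the expansion leaves p^(j+1+A) dividing p^j t (a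
    - 1), with a the derivative at x, which forces p to divide t. *)
Lemma exceptional_lift_unique (p : nat) (f : {poly int}) (j A : nat)
    (c : seq 'Z_(p ^ j)) (d e : seq 'Z_(p ^ j.+1)) (x y : int)
    (k := size c) :
    prime p -> (0 < A)%N -> (A < j)%N ->
    is_cycle f c -> is_lift f c d -> is_lift f c e ->
    x%:~R \in d -> y%:~R \in e ->
    (p%:Z ^+ A %| cycle_a f k x - 1)%Z ->
    ~~ (p%:Z ^+ A.+1 %| cycle_a f k x - 1)%Z ->
    (p%:Z ^+ (j.+1 + A) %| displacement f k x)%Z ->
    (p%:Z ^+ (j.+1 + A) %| displacement f k y)%Z ->
  e =i d.
Proof.
move=> hp A0 Aj cc ld le xd ye pA nA dx dy; have p1 := prime_gt1 hp.
have j0 : (0 < j)%N := leq_ltn_trans (leq0n A) Aj.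
have pa : (p %| cycle_a f k x - 1)%Z.
  by apply: dvdz_trans pA; rewrite dvdz_exp.
have xc := lift_reduce p1 j0 ld xd; have yc := lift_reduce p1 j0 le ye.
have [_ _ [i [t [w [r [yE cw]]]]]] := displacement_cycle p1 j0 cc xc yc pa.
move=> dyE; move: dy.
rewrite dyE dvdz_addr; last by rewrite dvdz_mulr // dvdz_exp2l // addSnnS leq_add2l.
rewrite (dvdz_addl _ (dvdz_mull w dx)); case/dvdzP: pA nA => u ->.
have pn0 m : p%:Z ^+ m != 0 by rewrite expf_neq0 // -lt0n prime_gt0.
rewrite exprS dvdz_mul2r // => nu.
have -> : p%:Z ^+ j * t * (u * p%:Z ^+ A) = u * t * p%:Z ^+ (j + A).
  by rewrite exprD; ring.
rewrite addSn exprS dvdz_mul2r // Gauss_dvdzr; last by rewrite coprimezE prime_coprime.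
move=> pt; have [[cd _] [ce _]] := (ld, le).
(* Now y is f^i(x) mod p^(j+1), so the two cycles share an element. *)
have yd : y%:~R \in d.
  have -> : y%:~R = iter i (@fmod p f j.+1) x%:~R.
    apply/eqP; rewrite iter_fmod_intr // intr_Zpow_eq // yE addrAC subrr add0r.
    by rewrite exprSr dvdz_mul.
  case/and3P: cd => _ fd _; elim: (i) => //= m IH.
  by rewrite -(fconnect_cycle fd IH) fconnect1.
case/and3P: cd ce => _ fd _ /and3P[_ fe _].
exact: (fcycle_eq_mem fe fd ye yd).
Qed.

(** * The three cases *)

Theorem mainTheorem7 (p : nat) (f : {poly int}) (n : nat)
    (sigma : seq 'Z_(p ^ n)) (x : int)
    (hp : prime p) (hodd : odd p) (hn : (1 <= n)%N)
    (hcycle : is_cycle f sigma) (hsplits : splits f sigma)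
    (hx : x%:~R = head 0 sigma) :
  let A := ord_p p (cycle_a f (size sigma) x - 1) in
  let B := ord_p p (cycle_b p f n (size sigma) x) in
  [/\ forall B0 : nat, B = Some B0 ->
        ord_lt B A -> ord_lt B (Some n) ->
        forall tau : seq 'Z_(p ^ n.+1), is_lift f sigma tau ->
          splits_times_then_grows f (B0 - 1) tau,
      forall A0 : nat, A = Some A0 ->
        ord_le A B -> ord_lt A (Some n) ->
        exists s : forall j : nat, seq 'Z_(p ^ j),
          s n = sigma /\
          forall j : nat, (n <= j)%N ->
            [/\ is_cycle f (s j),
                splits f (s j),
                is_lift f (s j) (s j.+1) &
                forall tau : seq 'Z_(p ^ j.+1), is_lift f (s j) tau ->
                  ~ (tau =i s j.+1) ->
                  splits_times_then_grows f (A0 - 1) tau] &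
      ord_le (Some n) A -> ord_le (Some n) B ->
        forall tau : seq 'Z_(p ^ n.+1), is_lift f sigma tau ->
          splits_times f (n - 1) tau].
Proof.
move=> A B; have p1 := prime_gt1 hp; have p0 := prime_gt0 hp.
have xs : x%:~R \in sigma.
  by rewrite hx; case/and3P: hcycle; case: (sigma) => //= z c _ _ _; rewrite mem_head.
have [pa pd] := splits_mem p1 hn hcycle hsplits xs.
have pn : (p%:Z ^+ n %| displacement f (size sigma) x)%Z.
  by rewrite -(size_cycle_dvd _ p1 hn hcycle xs).
(* Infinite valuations are covered, as 0 is divisible by every power of p. *)
have leB v : ord_le (Some v) B
    = (p%:Z ^+ (n + v) %| displacement f (size sigma) x)%Z.
  by rewrite /B ord_le_dvd // cycle_b_dvd.
have leA v : ord_le (Some v) A = (p%:Z ^+ v %| cycle_a f (size sigma) x - 1)%Z.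
  by rewrite /A ord_le_dvd.
have pnM v : (p%:Z ^+ v %| cycle_a f (size sigma) x - 1)%Z ->
    (p%:Z ^+ (n + v) %| p%:Z ^+ n * (cycle_a f (size sigma) x - 1))%Z.
  by rewrite exprD; apply: dvdz_mul.
split.
- move=> B0 BE; rewrite BE !ord_lt_Some leA => B0A B0n tau lt.
  (* Makes B0 - 1 an honest subtraction: (n + 1) + (B0 - 1) = n + B0. *)
  have B00 : (0 < B0)%N.
    by move: (leB 1%N); rewrite addn1 pd BE.
  apply: splits_times_then_grows_dvd => //; first by case: lt.
  rewrite (size_lift_splits p1 hn hcycle hsplits lt) => y /(lift_reduce p1 hn lt) ys.
  have [_ py _] := displacement_cycle p1 hn hcycle xs ys pa.
  rewrite subn1 addSnnS prednK // -addnS; split=> //.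
    rewrite (displacement_cycle_dvd p1 hn hcycle xs ys pa) ?leq_add2l 1?ltnW //.
      by rewrite -leB BE /=.
    by apply/pnM/dvdz_trans/B0A; rewrite dvdz_exp2l.
  (* The strict bounds B < A and B < n allow the comparison at the exponent n + B0 + 1 too. *)
  rewrite (displacement_cycle_dvd p1 hn hcycle xs ys pa) ?leq_add2l //.
    by rewrite -leB BE /= ltnn.
  exact: pnM.
- move=> A0 AE; rewrite AE leB ord_lt_Some => A0B A0n.
  have [pA nA] := ord_p_Some hp AE.
  have A00 : (0 < A0)%N.
    by move: (leA 1%N); rewrite expr1 pa AE.
  set k := size sigma in pa pd pn pA nA A0B leA leB pnM *.
  (* The hypotheses of case (2) at level j: a - 1 has valuation exactly A0, and b has valuation at
     least A0. *)
  pose good j y := [&& (p%:Z ^+ A0 %| cycle_a f k y - 1)%Z,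
    ~~ (p%:Z ^+ A0.+1 %| cycle_a f k y - 1)%Z
    & (p%:Z ^+ (j + A0) %| displacement f k y)%Z].
  (* The implication makes [step] total, so the recursion below carries no proofs; where its premise
     fails any value will do. *)
  have step j y : {z | (n <= j)%N && good j y ==>
      (p%:Z ^+ j %| z - y)%Z && good j.+1 z}.
    apply: sigW; case: (boolP (_ && good j y)) => [|_]; last by exists y.
    case/andP=> nj /and3P[ya yna yd].
    have A0j := leq_trans A0n nj.
    have [z /andP[zy zd]] := exceptional_lift_exists hp A00 A0j ya yna yd.
    exists z; rewrite /good zy zd andbT /=.
    (* As z = y mod p^j and A0 + 1 <= j, the exact valuation A0 of a - 1 survives. *)
    have zya v : (v <= j)%N -> (p%:Z ^+ v %| cycle_a f k z - cycle_a f k y)%Z.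
      by move=> vj; apply: dvdz_horner_sub; apply: dvdz_trans zy; rewrite dvdz_exp2l.
    rewrite -(subrK (cycle_a f k y) (cycle_a f k z)) -[_ + _ - 1]addrA.
    by rewrite (dvdz_addl _ (zya _ A0j)) (dvdz_addl _ (zya _ (ltnW A0j))) ya yna.
  have stepP j y : (n <= j)%N -> good j y ->
      (p%:Z ^+ j %| sval (step j y) - y)%Z && good j.+1 (sval (step j y)).
    by move=> nj gy; have /implyP H := svalP (step j y); apply/H/andP.
  (* These integers converge p-adically to a fixed point of f^k, whose orbit reduces to the
     exceptional chain. *)
  pose Y := fix Y i := if i is i'.+1 then sval (step (n + i')%N (Y i')) else x.
  have Ygood i : good (n + i)%N (Y i).
    elim: i => [|i IH]; first by rewrite addn0; apply/and3P.
    by have /andP[_] := stepP _ _ (leq_addr i n) IH; rewrite addnS.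
  have Ynear i : (p%:Z ^+ (n + i) %| Y i.+1 - Y i)%Z.
    by have /andP[] := stepP _ _ (leq_addr i n) (Ygood i).
  (* For j < n the difference j - n truncates to 0; such levels are unconstrained. *)
  pose s j := traject (@fmod p f j) (Y (j - n)%N)%:~R k.
  have sn : s n = sigma.
    by rewrite /s subnn /= hx [RHS](is_cycle_traject hcycle).
  have sS j : (n <= j)%N -> is_cycle f (s j) -> is_lift f (s j) (s j.+1).
    move=> nj cj; rewrite /s subSn //; apply: traject_is_lift => //.
    - exact: leq_trans nj.
    - by have := Ynear (j - n)%N; rewrite subnKC.
    - case/and3P: (Ygood (j - n).+1) => _ _; rewrite addnS subnKC //.
      by apply: dvdz_trans; rewrite dvdz_exp2l // leq_addr.
  have sc j : (n <= j)%N -> is_cycle f (s j).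
    move=> /subnKC <-; elim: (j - n)%N => [|i IH]; first by rewrite addn0 sn.
    by rewrite addnS; case: (sS (n + i)%N (leq_addr _ _) IH).
  have k0 : (0 < k)%N by rewrite lt0n size_eq0; case/and3P: hcycle.
  exists s; split=> // j nj; have j0 := leq_trans hn nj.
  have Ys i : (Y (i - n)%N)%:~R \in s i.
    by rewrite /s; case: (k) k0 => //= k' _; rewrite mem_head.
  have ssz i : size (s i) = k by rewrite size_traject.
  have /and3P[Ya Yna Yd] := Ygood (j - n)%N; rewrite subnKC // in Yd.
  have /and3P[Za Zna Zd] := Ygood (j.+1 - n)%N; rewrite subnKC ?leqW // in Zd.
  have Yp : (p %| cycle_a f k (Y (j - n)%N) - 1)%Z.
    by apply: dvdz_trans Ya; rewrite dvdz_exp.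
  have A0j := leq_trans A0n nj.
  (* A0 < j puts j + A0 within the range 2j of the comparison, so the divisibility known at [Y]
     spreads over the cycle. *)
  have dvdY y M : y%:~R \in s j -> (M <= j + A0)%N -> (p%:Z ^+ M %| displacement f k y)%Z.
    move=> ys Mj; have := @displacement_cycle_dvd p f j (j + A0) (s j) (Y (j - n)%N) y.
    rewrite ssz => /(_ p1 j0 (sc _ nj) (Ys j) ys Yp) H.
    apply: (@dvdz_trans (p%:Z ^+ (j + A0))); first by rewrite dvdz_exp2l.
    by rewrite H // ?leq_add2l 1?ltnW // exprD dvdz_mul.
  have splitA y : y%:~R \in s j -> (p %| cycle_a f k y - 1)%Z.
    move=> ys; have := @displacement_cycle p f j (s j) (Y (j - n)%N) y.
    by rewrite ssz => /(_ p1 j0 (sc _ nj) (Ys j) ys Yp) [].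
  have sj : splits f (s j).
    apply/(splits_cycleP p1 j0 (sc _ nj)); have cm := cycle_rep_mem (sc _ nj).
    by rewrite ssz splitA // dvdY // -addn1 leq_add2l.
  split; [exact: sc|exact: sj|by apply: sS => //; exact: sc|].
  move=> tau lt neq.
  apply: splits_times_then_grows_dvd => //; first by case: lt.
  rewrite (size_lift_splits p1 j0 (sc _ nj) sj lt) ssz => y yt.
  have ys := lift_reduce p1 j0 lt yt.
  rewrite subn1 addSnnS prednK //; split; [exact: splitA|exact: dvdY|].
  (* One more factor p in the displacement would make [tau] the exceptional lift. *)
  apply/negP => dy; apply: neq.
  apply: (exceptional_lift_unique hp A00 A0j (sc _ nj) (sS _ nj (sc _ nj)) lt (Ys _) yt);
    by rewrite ?ssz.
- rewrite leA leB => nA nB tau lt.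
  apply: splits_times_dvd => //; first by case: lt.
  rewrite (size_lift_splits p1 hn hcycle hsplits lt) => y /(lift_reduce p1 hn lt) ys.
  have [_ py _] := displacement_cycle p1 hn hcycle xs ys pa.
  (* (n + 1) + (n - 1) = 2n, the largest exponent the expansion controls. *)
  rewrite subn1 addSnnS prednK //; split=> //.
  by rewrite (displacement_cycle_dvd p1 hn hcycle xs ys pa) // pnM.
Qed.
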